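(* Let $T$ be a tree with color classes $B$ and $W$, let $n$ be a positive integer, let $h: T^n \to \mathbf{R}\cup\{\infty\}$ be a midpoint L-extendable function, and let $x$ be a minimizer of $h$ over $B^n$. Then there exists a minimizer $y$ of $h$ (over $T^n$) with $d(x,y) \le 2n$. In addition, if $h$ admits an exact L-convex relaxation, then there exists a minimizer $y$ of $h$ with $d(x,y) \le n$.
   Context: The vertex set of a tree $T$ is also denoted by $T$, and $d$ denotes the path metric of $T$; on $T^n$, $d(x,y) := \max_{1\le i\le n} d(x_i,y_i)$. $T$ is regarded as a bipartite graph with color classes $B$ and $W$. L-convexity. Let $T'$ be a tree with its two color classes called black and white, and path metric $d'$. For adjacent $u$ white and $v$ black write $u \prec v$. For $u,v \in T'$ there is a unique pair $(a,b)$ of vertices with $d'(u,v) = d'(u,a)+d'(a,b)+d'(b,v)$, $d'(u,a)=d'(b,v)$ and $d'(a,b)\le 1$. Define $u\bullet v, u\circ v$ by $\{u\bullet v,u\circ v\}=\{a,b\}$ and $u\circ v \preceq u\bullet v$; extend componentwise to $(T')^n$. A function $g:(T')^n\to \mathbf{R}\cup\{\infty\}$ is L-convex if $g(p)+g(q)\ge g(p\bullet q)+g(p\circ q)$ for all $p,q\in (T')^n$. Midpoint L-extendability. The edge-subdivision $T^*$ of $T$ is obtained by replacing each edge $uv$ by two edges $uw_{uv}, w_{uv}v$ with a new vertex $w_{uv}$ (the midpoint of $uv$). In $T^*$, the vertices of $T$ are black and the midpoints are white. A function $h:T^n\to\mathbf{R}\cup\{\infty\}$ is midpoint L-extendable if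 there is an L-convex function $g$ on $(T^* )^n$ whose restriction to $T^n$ equals $h$; such $g$ is called an L-convex relaxation of $h$, and it is called exact if $\min_{p\in T^n} h(p) = \min_{p \in (T^* )^n} g(p)$.
   Formalization: The minimizer x of h over B^n is required to have h(x) < ∞; without this the claim fails, e.g. for n = 1 and h finite only at one vertex of W far from x. *)

(* Defs.v *)
From mathcomp Require Export all_boot all_order all_algebra.
From mathcomp Require Export all_classical all_reals ereal.

Set Implicit Arguments.
Unset Strict Implicit.
Unset Printing Implicit Defensive.

Import Order.TTheory GRing.Theory Num.Theory.

Local Open Scope classical_set_scope.

Section Graphs.
Variables (T : choiceType) (e : rel T).

(* Trees may be infinite.  The bound 2 discards the degenerate closed walks
   [:: u; v] which mathcomp regards as cycles of a symmetric relation. *)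
Definition is_tree : Prop :=
  [/\ symmetric e, irreflexive e,
      forall u v, exists2 s, path e u s & last u s = v
    & forall c, ucycle e c -> size c <= 2].

Definition color_classes (B W : pred T) : Prop :=
  (forall u, W u = ~~ B u) /\ (forall u v, e u v -> B u != B v).

Definition walk_length (u v : T) : pred nat :=
  fun k => `[< exists s, [/\ path e u s, last u s = v & size s = k] >].

(* The value 0 for disconnected u, v is a dummy. *)
Definition dist (u v : T) : nat :=
  if pselect (exists k, walk_length u v k) is left uv then ex_minn uv else 0.

Definition dist_prod n (x y : {ffun 'I_n -> T}) : nat :=
  \max_(i < n) dist (x i) (y i).

(* In a tree the pair (a, b) exists and is unique, so that the default value
   of xget is never used. *)
Definition midpair (u v : T) : T * T :=
  xget (u, v) [set ab | [/\ dist u v = dist u ab.1 + dist ab.1 ab.2 + dist ab.2 v,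
                            dist u ab.1 = dist ab.2 v
                          & dist ab.1 ab.2 <= 1]].

Variable black : pred T.

Definition prec (u v : T) : bool := [&& e u v, ~~ black u & black v].

Definition preceq (u v : T) : bool := (u == v) || prec u v.

Definition bullet (u v : T) : T :=
  let: (a, b) := midpair u v in if preceq a b then b else a.

Definition circle (u v : T) : T :=
  let: (a, b) := midpair u v in if preceq a b then a else b.

Definition bullet_prod n (p q : {ffun 'I_n -> T}) : {ffun 'I_n -> T} :=
  [ffun i => bullet (p i) (q i)].

Definition circle_prod n (p q : {ffun 'I_n -> T}) : {ffun 'I_n -> T} :=
  [ffun i => circle (p i) (q i)].

(* The codomain R \cup {oo} is \bar R with the value -oo excluded. *)
Definition L_convex (R : realType) n (g : {ffun 'I_n -> T} -> \bar R) : Prop :=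
  (forall p, -oo < g p)%E /\
  (forall p q, g (bullet_prod p q) + g (circle_prod p q) <= g p + g q)%E.

End Graphs.

Section Minimizers.
Variables (R : realType) (X : Type) (f : X -> \bar R).

Definition minimizer_over (S : set X) (x : X) : Prop :=
  S x /\ forall y, S y -> (f x <= f y)%E.

Definition is_minimum (m : \bar R) : Prop :=
  exists2 x, minimizer_over setT x & f x = m.

End Minimizers.

Section Subdivision.
Variables (T : choiceType) (e : rel T).

Definition edge : choiceType :=
  {A : set T | `[< exists u v, e u v /\ A = [set u; v] >]}.

(* inl u is the vertex u of T, and inr A is the midpoint of the edge A. *)
Definition subdiv : choiceType := (T + edge)%type.

Definition subdiv_adj : rel subdiv := fun a b =>
  match a, b with
  | inl u, inr A | inr A, inl u => `[< val A u >]
  | _, _ => false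
  end.

Definition subdiv_black : pred subdiv := fun a => if a is inl _ then true else false.

Definition subdiv_embed n (p : {ffun 'I_n -> T}) : {ffun 'I_n -> subdiv} :=
  [ffun i => inl (p i)].

Variables (R : realType) (n : nat) (h : {ffun 'I_n -> T} -> \bar R).

Definition L_convex_relaxation (g : {ffun 'I_n -> subdiv} -> \bar R) : Prop :=
  L_convex subdiv_adj subdiv_black g /\ forall p, g (subdiv_embed p) = h p.

Definition midpoint_L_extendable : Prop := exists g, L_convex_relaxation g.

(* Both minima are required to be attained, which is automatic when T is
   finite. *)
Definition exact_L_convex_relaxation (g : {ffun 'I_n -> subdiv} -> \bar R) : Prop :=
  L_convex_relaxation g /\ exists m, is_minimum h m /\ is_minimum g m.

End Subdivision.

(* Main.v *)
(* Fix a geodesic from x_i to y_i in every coordinate.  On the resulting box an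
   L-convex function g becomes a function G of integer points (even coordinates
   are vertices of T, odd ones midpoints) that is midpoint convex for the
   rounding to even and the rounding to odd coordinates.  Let D_i = d(x_i, y_i),
   and for a set X of levels let Phi(X) be the value of h at the point of the box
   whose i-th coordinate is the number of levels of X below D_i.  Midpoint
   convexity makes Phi supermodular locally, and globally because the sets where
   Phi is finite leave no gap between comparable sets.  If some D_i exceeds n,
   then a level v with 1 <= v <= n is missed by all D_i, and supermodularity
   for the pair of levels v - 1, v gives h(x') + h(y') <= h(x) + h(y), where x'
   and y' arise by moving x and y two steps towards each other in the coordinates
   with D_i > v.  As x' remains in B^n, h(y') <= h(y), and y' is closer to x.
   Hence distances at most n suffice, for every relaxation.  When T is not locally
   finite, the minimum over the ball is attained because two points with the same
   distances to x in all coordinates have a midpoint in T^n, which is closer to x. *)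
Require Import Defs.
From mathcomp Require Import all_boot all_order all_algebra.
From mathcomp Require Import all_classical all_reals ereal.
From mathcomp Require Import zify lra.

Set Implicit Arguments.
Unset Strict Implicit.
Unset Printing Implicit Defensive.

Import Order.TTheory GRing.Theory Num.Theory.

(** Transfers finiteness from the larger side of an inequality to the smaller one, after which the
    inequalities can be added up in the reals. *)
Lemma fin_num_le_adde (R : realDomainType) (a b c d : \bar R) :
  (-oo < a)%E -> (-oo < b)%E -> (a + b <= c + d)%E ->
  c \is a fin_num -> d \is a fin_num -> (a \is a fin_num) && (b \is a fin_num).
Proof. by case: a b c d => [a||] [b||] [c||] [d||]. Qed.

Lemma adde_pinfty_or_fin (R : realDomainType) (a b : \bar R) :
  (-oo < a)%E -> (-oo < b)%E ->
  (a + b = +oo)%E \/ (a \is a fin_num) && (b \is a fin_num).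
Proof. by case: a b => [a||] [b||] // _ _; [right|left|left|left]. Qed.

(** * From local to global supermodularity *)

Section Supermodular.
Variables (R : realType) (T : finType) (Phi : {set T} -> \bar R).
Local Open Scope ereal_scope.
Hypothesis Phi_gt : forall X, -oo < Phi X.
Hypothesis Phi_loc : forall (X : {set T}) s t, s != t -> s \notin X -> t \notin X ->
  Phi (s |: X)%SET + Phi (t |: X)%SET <= Phi X + Phi (s |: (t |: X))%SET.
Hypothesis Phi_mid : forall X Y : {set T}, X \subset Y -> (2 < #|(Y :\: X)%SET|)%N ->
  Phi X \is a fin_num -> Phi Y \is a fin_num ->
  exists W : {set T}, [/\ X \proper W, W \proper Y & Phi W \is a fin_num].

(** Let Z' be the complement X :|: (Y :\: Z) of Z in the interval from X to Y. This is
    supermodularity for Z and Z', whose intersection is X and whose union is Y. The proof is by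
    induction on the size of Y :\: X: for two elements it is [Phi_loc], and a larger interval is
    split at a set W with [Phi W] finite. *)
Lemma supermodular_complement (X Y Z : {set T}) : X \subset Z -> Z \subset Y ->
  Phi Z + Phi (X :|: (Y :\: Z))%SET <= Phi X + Phi Y.
Proof.
have [k] := ubnP #|(Y :\: X)%SET|; elim: k X Y Z => // k IH X Y Z ltk XZ ZY.
have [XY|/andP[finX finY]] := adde_pinfty_or_fin (Phi_gt X) (Phi_gt Y).
  by rewrite XY leey.
have sXY := fintype.subset_trans XZ ZY.
have [eXZ|neXZ] := eqVneq X Z.
  have -> : (X :|: (Y :\: Z) = Y)%SET.
    by rewrite -eXZ -{1}(finset.setIidPr sXY) finset.setID.
  by rewrite eXZ.
have [eZY|neZY] := eqVneq Z Y.
  by rewrite eZY finset.setDv finset.setU0 addeC.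
have /fintype.properP[_ [s sZ sX]] : X \proper Z by rewrite finset.properEneq neXZ.
have /fintype.properP[_ [t tY tZ]] : Z \proper Y by rewrite finset.properEneq neZY.
have tX : t \notin X by apply: contra tZ; apply/fintype.subsetP.
have sY : s \in Y by apply: (fintype.subsetP ZY).
have neq_st : s != t by apply: contraNneq tZ => <-.
have [card2|card3] := leqP #|(Y :\: X)%SET| 2.
  have YX : (Y :\: X = [set s; t])%SET.
    apply/esym/eqP; rewrite eqEcard cards2 neq_st card2 andbT.
    by apply/fintype.subsetP=> u; rewrite !inE => /orP[] /eqP->; apply/andP.
  have inY u : u \in Y = [|| u == s, u == t | u \in X].
    have /finset.setP/(_ u) := YX; rewrite !inE; case: (boolP (u \in X)) => /= [uX _|_ ->].
      by rewrite (fintype.subsetP sXY) // !orbT.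
    by rewrite orbF.
  have inZ u : u \in Z = (u == s) || (u \in X).
    apply/idP/idP => [uZ|/orP[/eqP->//|]]; last by apply/fintype.subsetP.
    have := fintype.subsetP ZY _ uZ; rewrite inY => /or3P[->//|/eqP ut|->].
      by rewrite ut (negPf tZ) in uZ.
    by rewrite orbT.
  have -> : Z = (s |: X)%SET by apply/finset.setP=> u; rewrite inZ !inE.
  have -> : Y = (s |: (t |: X))%SET by apply/finset.setP=> u; rewrite inY !inE.
  have -> : (X :|: ((s |: (t |: X)) :\: (s |: X)) = t |: X)%SET; last exact: Phi_loc.
  apply/finset.setP=> u; rewrite !inE negb_or.
  have [->|_] /= := eqVneq u s; first by rewrite (negPf sX) (negPf neq_st).
  by case: (u \in X); rewrite ?orbT ?orbF.
set Z' := (X :|: (Y :\: Z))%SET.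
have subs (V V' : {set T}) : V \subset V' -> forall u, (u \in V) ==> (u \in V').
  by move=> VV' u; apply/implyP/(fintype.subsetP VV').
(* The exchanges on the intervals from Z :&: W to Z :|: W, from Z' :&: W to Z' :|: W, from X to W
   and from W to Y add up to the claim with 2 [Phi W] on both sides, which cancels. *)
have through (W : {set T}) : X \proper W -> W \proper Y -> W != Z -> W != Z' ->
    Phi W \is a fin_num -> Phi Z + Phi Z' <= Phi X + Phi Y.
  move=> XW WY WZ WZ' finW.
  have [sXW [w wW wX]] := fintype.properP XW.
  have [sWY [v vY vW]] := fintype.properP WY.
  have pt u : [&& (u \in X) ==> (u \in Z), (u \in Z) ==> (u \in Y),
      (u \in X) ==> (u \in W) & (u \in W) ==> (u \in Y)] by rewrite !subs.
  have set_eq (V V' : {set T}) : (forall u, u \in V = (u \in V')) -> V = V'.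
    by move=> VV'; apply/finset.setP.
  have card_lt (V V' : {set T}) : V' :\: V \proper Y :\: X -> (#|(V' :\: V)%SET| < k)%N.
    by move=> /proper_card lt; rewrite -ltnS (leq_trans _ ltk) // ltnS.
  have cardW : (#|(W :\: X)%SET| < k)%N.
    apply/card_lt/fintype.properP; split; first exact: finset.setSD.
    by exists v; move: (pt v); rewrite !inE vY (negPf vW); do 2!case: (v \in _).
  have cardY : (#|(Y :\: W)%SET| < k)%N.
    apply/card_lt/fintype.properP; split; first exact: finset.setDS.
    by exists w; move: (pt w); rewrite !inE wW (negPf wX); do 2!case: (w \in _).
  (* The symmetric difference of V and W fills Y :\: X only if W is the complement V' of V. Hence W
     must avoid both Z and Z'. *)
  have card_sd (V V' : {set T}) : V' = (X :|: (Y :\: V))%SET -> X \subset V -> V \subset Y ->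
      W != V' -> (#|((V :|: W) :\: (V :&: W))%SET| < k)%N.
    move=> -> XV VY WV'; apply: card_lt; rewrite finset.properEneq; apply/andP; split.
      apply: contra WV' => /eqP/finset.setP E; apply/eqP/finset.setP => u.
      move: (E u) (pt u) (subs _ _ XV u) (subs _ _ VY u); rewrite !inE.
      by do 5!case: (u \in _) => //=.
    apply/fintype.subsetP => u; move: (pt u) (subs _ _ XV u) (subs _ _ VY u); rewrite !inE.
    by do 5!case: (u \in _) => //=.
  have cardZ := card_sd Z Z' erefl XZ ZY WZ'.
  have cardZ' : (#|((Z' :|: W) :\: (Z' :&: W))%SET| < k)%N.
    apply: card_sd WZ => //; first by apply/finset.setP => u; move: (pt u); rewrite /Z' !inE; do 4!case: (u \in _) => //=.
    - exact: finset.subsetUl.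
    - by rewrite finset.subUset sXY finset.subsetDl.
  have exch (A C V V' : {set T}) : (#|(C :\: A)%SET| < k)%N -> A \subset V -> V \subset C ->
      (forall u, u \in (A :|: (C :\: V))%SET = (u \in V')) -> Phi V + Phi V' <= Phi A + Phi C.
    by move=> lt AV VC /finset.setP <-; exact: IH.
  have i1 : Phi Z' + Phi W <= Phi (Z' :&: W)%SET + Phi (Z' :|: W)%SET.
    apply: exch; rewrite ?finset.subsetIl ?finset.subsetUl // => u.
    by rewrite !inE; do 4!case: (u \in _).
  have i2 : Phi Z + Phi W <= Phi (Z :&: W)%SET + Phi (Z :|: W)%SET.
    apply: exch; rewrite ?finset.subsetIl ?finset.subsetUl // => u.
    by rewrite !inE; do 2!case: (u \in _).
  have i3 : Phi (Z :|: W)%SET + Phi (Z' :|: W)%SET <= Phi W + Phi Y.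
    apply: exch; rewrite ?finset.subsetUr ?finset.subUset ?ZY // => u.
    by move: (pt u); rewrite /Z' !inE; do 4!case: (u \in _).
  have i4 : Phi (Z :&: W)%SET + Phi (Z' :&: W)%SET <= Phi X + Phi W.
    apply: exch; rewrite ?finset.subsetIr ?finset.subsetI ?XZ // => u.
    by move: (pt u); rewrite /Z' !inE; do 4!case: (u \in _).
  have /andP[f1 f2] := fin_num_le_adde (Phi_gt _) (Phi_gt _) i3 finW finY.
  have /andP[f3 f4] := fin_num_le_adde (Phi_gt _) (Phi_gt _) i4 finX finW.
  have /andP[f5 _] := fin_num_le_adde (Phi_gt _) (Phi_gt _) i2 f3 f1.
  have /andP[f6 _] := fin_num_le_adde (Phi_gt _) (Phi_gt _) i1 f4 f2.
  move: i1 i2 i3 i4; rewrite -(fineK finW) -(fineK finX) -(fineK finY) -(fineK f1).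
  rewrite -(fineK f2) -(fineK f3) -(fineK f4) -(fineK f5) -(fineK f6) -!EFinD !lee_fin.
  by move=> *; lra.
have [W [XW WY finW]] := Phi_mid sXY card3 finX finY.
have [sXW [w wW wX]] := fintype.properP XW.
have [sWY [v vY vW]] := fintype.properP WY.
have [/andP[neWZ neWZ']|] := boolP ((W != Z) && (W != Z')); first exact: (through W).
rewrite negb_and !negbK => eW.
have card_lt (V V' : {set T}) : V' :\: V \proper Y :\: X -> (#|(V' :\: V)%SET| < k)%N.
  by move=> /proper_card lt; rewrite -ltnS (leq_trans _ ltk) // ltnS.
have fin_between (A V C : {set T}) : (#|(C :\: A)%SET| < k)%N -> A \subset V -> V \subset C ->
    Phi A \is a fin_num -> Phi C \is a fin_num -> Phi V \is a fin_num.
  by move=> lt AV VC fA fC; have /andP[] := fin_num_le_adde (Phi_gt _) (Phi_gt _) (IH _ _ _ lt AV VC) fA fC.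
have neq_mem (A C : {set T}) u : u \in A != (u \in C) -> A != C by apply: contraNneq => ->.
have {}through (W2 : {set T}) : X \proper W2 -> W2 \proper Y -> W2 != W ->
    W2 != (X :|: (Y :\: W))%SET -> Phi W2 \is a fin_num -> Phi Z + Phi Z' <= Phi X + Phi Y.
  move=> XW2 W2Y; case/orP: eW => /eqP->; first exact: through.
  move=> W2Z' W2Z; apply: through => //; apply: contra W2Z => /eqP->; apply/eqP/finset.setP => u.
  by have := subs _ _ XZ u; have := subs _ _ ZY u; rewrite /Z' !inE; do 3!case: (u \in _).
(* Now W is Z or Z'. As Y :\: X has more than two elements, W :\: X or Y :\: W has at least two.
   Adding just one of them to X or to W, respectively, gives a set other than W and its complement,
   whose value is finite by induction. *)
have [/card_gt1P[a [b [/setDP[aW aX] /setDP[bW bX] neq_ab]]]|leW] := ltnP 1 #|(W :\: X)%SET|.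
  have sXaX : X \subset (a |: X)%SET by exact: finset.subsetUr.
  have saXW : (a |: X)%SET \subset W by rewrite finset.subUset finset.sub1set aW.
  have bNaX : b \notin (a |: X)%SET by rewrite !inE eq_sym negb_or neq_ab.
  apply: (through (a |: X)%SET).
  - by apply/fintype.properP; split=> //; exists a; rewrite ?inE ?eqxx.
  - apply/fintype.properP; split; first exact: fintype.subset_trans sWY.
    by exists b => //; apply: (fintype.subsetP sWY).
  - by apply: (neq_mem _ _ b); rewrite bW (negPf bNaX).
  - by apply: (neq_mem _ _ a); rewrite !inE eqxx aW (negPf aX).
  - apply: (fin_between X _ W) => //; apply/card_lt/fintype.properP; split.
      exact: finset.setSD.
    by exists v; rewrite !inE ?(negPf vW) ?andbF ?vY ?andbT //; apply: contra vW; apply/fintype.subsetP.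
have /card_gt1P[a [b [/setDP[aY aW] /setDP[bY bW] neq_ab]]] : (1 < #|(Y :\: W)%SET|)%N.
  have : (#|(Y :\: X)%SET| <= #|(W :\: X)%SET| + #|(Y :\: W)%SET|)%N.
    apply: leq_trans (leq_card_setU _ _); apply/subset_leq_card/fintype.subsetP => u.
    by rewrite !inE; do 3!case: (u \in _).
  move=> le; rewrite ltnNge; apply/negP => le1.
  by have := leq_trans le (leq_add leW le1); rewrite leqNgt card3.
have sWaW : W \subset (a |: W)%SET by exact: finset.subsetUr.
have saWY : (a |: W)%SET \subset Y by rewrite finset.subUset finset.sub1set aY.
have bNaW : b \notin (a |: W)%SET by rewrite !inE eq_sym negb_or neq_ab.
apply: (through (a |: W)%SET).
- apply/fintype.properP; split; first exact: fintype.subset_trans sWaW.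
  by exists w => //; apply: (fintype.subsetP sWaW).
- by apply/fintype.properP; split=> //; exists b.
- by apply: (neq_mem _ _ a); rewrite !inE eqxx (negPf aW).
- by apply: (neq_mem _ _ w); rewrite !inE wW (negPf wX) orbT.
- apply: (fin_between W _ Y) => //; apply/card_lt/fintype.properP; split.
    exact: finset.setDS.
  by exists w; rewrite !inE ?wW // wX; apply: (fintype.subsetP sWY).
Qed.
End Supermodular.

(* Along a geodesic of T^* starting at a vertex of T the even positions are
   black, so that these are the positions of p \bullet q and p \circ q. *)
Definition even_mid (a b : nat) : nat := (a + b)./2 + (odd (a + b) && odd (a + b)./2).
Definition odd_mid (a b : nat) : nat := (a + b)./2 + (odd (a + b) && ~~ odd (a + b)./2).

Lemma even_midDl p a b : ~~ odd p -> even_mid (p + a) (p + b) = p + even_mid a b.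
Proof. by rewrite /even_mid => p_even; lia. Qed.

Lemma odd_midDl p a b : ~~ odd p -> odd_mid (p + a) (p + b) = p + odd_mid a b.
Proof. by rewrite /odd_mid => p_even; lia. Qed.

Lemma even_mid_le a b c : a <= c -> b <= c -> even_mid a b <= c.
Proof. by rewrite /even_mid; lia. Qed.

Lemma odd_mid_le a b c : a <= c -> b <= c -> odd_mid a b <= c.
Proof. by rewrite /odd_mid; lia. Qed.

(** * Midpoint convex functions of integer points *)

Section MidpointConvex.
Variables (R : realType) (I : finType) (G : (I -> nat) -> \bar R).
Local Open Scope ereal_scope.
Hypothesis G_gt : forall a, -oo < G a.
Hypothesis G_mid : forall a b,
  G (fun i => even_mid (a i) (b i)) + G (fun i => odd_mid (a i) (b i)) <= G a + G b.

(** The midpoint is integral, so both roundings leave it unchanged. *)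
Lemma midpoint_exact (p t : I -> nat) :
  G (fun i => p i + t i)%N + G (fun i => p i + t i)%N <= G p + G (fun i => p i + 2 * t i)%N.
Proof.
have := G_mid p (fun i => p i + 2 * t i)%N.
have -> : (fun i => even_mid (p i) (p i + 2 * t i)) = (fun i => p i + t i)%N.
  by apply/funext => i; rewrite /even_mid; lia.
have -> // : (fun i => odd_mid (p i) (p i + 2 * t i)) = (fun i => p i + t i)%N.
by apply/funext => i; rewrite /odd_mid; lia.
Qed.

(* The iteration of a <- even_mid a t increases from 0 to the largest even
   vector below t. *)
Lemma fin_floor_half (p t : I -> nat) : (forall i, ~~ odd (p i)) ->
  G p \is a fin_num -> G (fun i => p i + 2 * t i)%N \is a fin_num ->
  G (fun i => p i + 2 * (t i)./2)%N \is a fin_num.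
Proof.
move=> p_even fin0 fin2.
have /andP[fin1 _] := fin_num_le_adde (G_gt _) (G_gt _) (midpoint_exact p t) fin0 fin2.
pose gap (a : I -> nat) := (\sum_i (2 * (t i)./2 - a i))%N.
suff : forall k a, (gap a < k)%N -> (forall i, a i <= 2 * (t i)./2)%N ->
    G (fun i => p i + a i)%N \is a fin_num -> G (fun i => p i + 2 * (t i)./2)%N \is a fin_num.
  move=> /(_ (gap (fun=> 0%N)).+1 (fun=> 0%N) (ltnSn _)); apply => //.
  by have -> : (fun i => p i + 0)%N = p by apply/funext => i; rewrite addn0.
elim=> // k IH a gap_a le_a fin_a.
have [/forallP eq_a|] := boolP [forall i, a i == 2 * (t i)./2]%N.
  have <- // : (fun i => p i + a i)%N = (fun i => p i + 2 * (t i)./2)%N.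
  by apply/funext => i; rewrite (eqP (eq_a i)).
rewrite negb_forall => /existsP[j neq_j].
apply: (IH (fun i => even_mid (a i) (t i))).
- rewrite -ltnS (leq_trans _ gap_a) // ltnS /gap.
  rewrite (bigD1 j) //= [X in (_ < X)%N](bigD1 j) //= -addSn; apply: leq_add.
    by have := le_a j; move: neq_j; rewrite /even_mid; lia.
  by apply: leq_sum => i _; have := le_a i; rewrite /even_mid; lia.
- by move=> i; have := le_a i; rewrite /even_mid; lia.
- have := G_mid (fun i => p i + a i)%N (fun i => p i + t i)%N.
  have -> : (fun i => even_mid (p i + a i) (p i + t i)) = (fun i => p i + even_mid (a i) (t i))%N.
    by apply/funext => i; rewrite even_midDl.
  by move=> /(fin_num_le_adde (G_gt _) (G_gt _))/(_ fin_a fin1)/andP[].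
Qed.

Lemma nested_supermodular (p : I -> nat) (J K : pred I) : (forall i, ~~ odd (p i)) ->
  (forall i, J i -> K i) ->
  G (fun i => p i + 2 * J i)%N + G (fun i => p i + 2 * K i)%N <=
  G p + G (fun i => p i + 2 * (J i + K i))%N.
Proof.
move=> p_even JK.
(* The functions constant on J, on K \ J and outside K form a plane, in which six
   midpoint inequalities around the point (2, 1) add up to the claim. *)
pose P u w := G (fun i => p i + if J i then u else if K i then w else 0)%N.
have mid u w u' w' : P (even_mid u u') (even_mid w w') + P (odd_mid u u') (odd_mid w w') <=
    P u w + P u' w'.
  rewrite /P; set a := (X in G X + _ <= _); set b := (X in _ + G X <= _).
  set c := (X in _ <= G X + _); set d := (X in _ <= _ + G X).
  have -> : a = fun i => even_mid (c i) (d i).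
    by apply/funext => i; rewrite even_midDl // /a; case: (J i) (K i) => [] [].
  have -> // : b = fun i => odd_mid (c i) (d i).
  by apply/funext => i; rewrite odd_midDl // /b; case: (J i) (K i) => [] [].
have -> : (fun i => p i + 2 * J i)%N = (fun i => p i + if J i then 2 else if K i then 0 else 0)%N.
  by apply/funext => i; case: (J i) (K i) => [] [].
have -> : (fun i => p i + 2 * K i)%N = (fun i => p i + if J i then 2 else if K i then 2 else 0)%N.
  by apply/funext => i; have := JK i; case: (J i) (K i) => [] [] // /(_ isT).
have -> : (fun i => p i + 2 * (J i + K i))%N =
    (fun i => p i + if J i then 4 else if K i then 2 else 0)%N.
  by apply/funext => i; have := JK i; case: (J i) (K i) => [] [] // /(_ isT).
have -> : G p = (P 0 0)%N.
  by rewrite /P; congr G; apply/funext => i; case: (J i) (K i) => [] []; rewrite addn0.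
have P_gt u w : -oo < P u w by exact: G_gt.
suff : (P 2 0)%N + (P 2 2)%N <= (P 0 0)%N + (P 4 2)%N by [].
have [->|/andP[f00 f42]] := adde_pinfty_or_fin (P_gt 0 0)%N (P_gt 4 2)%N; first by rewrite leey.
have i1 : (P 2 1)%N + (P 2 1)%N <= (P 0 0)%N + (P 4 2)%N := (mid 0 0 4 2)%N.
have /andP[f21 _] := fin_num_le_adde (P_gt _ _) (P_gt _ _) i1 f00 f42.
have i2 : (P 1 0)%N + (P 1 1)%N <= (P 0 0)%N + (P 2 1)%N.
  by have := (mid 0 0 2 1)%N; rewrite addeC.
have /andP[f10 f11] := fin_num_le_adde (P_gt _ _) (P_gt _ _) i2 f00 f21.
have i3 : (P 2 0)%N + (P 1 1)%N <= (P 1 0)%N + (P 2 1)%N := (mid 1 0 2 1)%N.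
have /andP[f20 _] := fin_num_le_adde (P_gt _ _) (P_gt _ _) i3 f10 f21.
have i4 : (P 3 2)%N + (P 3 1)%N <= (P 2 1)%N + (P 4 2)%N.
  by have := (mid 2 1 4 2)%N; rewrite addeC.
have /andP[f32 f31] := fin_num_le_adde (P_gt _ _) (P_gt _ _) i4 f21 f42.
have i5 : (P 2 2)%N + (P 3 1)%N <= (P 2 1)%N + (P 3 2)%N := (mid 2 1 3 2)%N.
have /andP[f22 _] := fin_num_le_adde (P_gt _ _) (P_gt _ _) i5 f21 f32.
have i6 : (P 2 1)%N + (P 2 1)%N <= (P 1 1)%N + (P 3 1)%N := (mid 1 1 3 1)%N.
(* The claim is [i2] + [i3] + [i4] + [i5] + 2 [i6]. *)
move: i2 i3 i4 i5 i6; rewrite -(fineK f00) -(fineK f42) -(fineK f21) -(fineK f10) -(fineK f11).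
rewrite -(fineK f20) -(fineK f32) -(fineK f31) -(fineK f22) -!EFinD !lee_fin.
by move=> *; lra.
Qed.

End MidpointConvex.

(** * Counting the levels below a threshold *)

Section CountBelow.
Variable M : nat.
Implicit Types (X Y Z : {set 'I_M}) (d : nat).

Definition count_below X d : nat := \sum_(s in X) (s < d).

Lemma count_belowT d : d <= M -> count_below [set: 'I_M] d = d.
Proof.
move=> dM; rewrite /count_below (eq_bigl xpredT) => [|s]; last by rewrite inE.
by rewrite -big_mkcond /= sum1_card -[RHS](card_ord d) -!sum1_card
     -(big_ord_widen_cond M xpredT (fun=> 1)) .
Qed.

Lemma count_below_ge X d : M <= d -> count_below X d = #|X|.
Proof.
by move=> Md; rewrite -sum1_card; apply: eq_bigr => s _; rewrite (leq_trans (ltn_ord s)).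
Qed.

Lemma count_belowU1 X s d : s \notin X -> count_below (s |: X)%SET d = (s < d) + count_below X d.
Proof. by move=> sX; rewrite /count_below big_setU1. Qed.

Lemma count_belowD X Y d : X \subset Y ->
  count_below Y d = count_below X d + count_below (Y :\: X)%SET d.
Proof.
by move=> XY; rewrite /count_below (big_setID X) /= (finset.setIidPr XY).
Qed.

Lemma count_belowU X Y d : [disjoint X & Y] ->
  count_below (X :|: Y)%SET d = count_below X d + count_below Y d.
Proof. by move=> XY; rewrite /count_below -bigU //; apply: eq_bigl => s; rewrite inE. Qed.

(* Every other element of Z, starting with the second one. *)
Definition odd_ranked Z : {set 'I_M} := [set s in Z | odd (count_below Z s)]%SET.

(** Passing from d to d + 1 can only add the level d to the count. This level lies in [odd_ranked Z]
    exactly when the count of Z so far is odd, that is, when its half is about to increase. So a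
    single set halves the counts for all thresholds at once. *)
Lemma count_odd_ranked Z d : count_below (odd_ranked Z) d = (count_below Z d)./2.
Proof.
pose at_level X k := \sum_(s in X) (s == k :> nat).
have countS X k : count_below X k.+1 = count_below X k + at_level X k.
  rewrite /count_below /at_level -big_split; apply: eq_bigr => s _ /=.
  by rewrite ltnS; case: ltngtP.
elim: d => [|d IH]; first by rewrite /count_below !big1.
rewrite !countS IH.
have -> : at_level (odd_ranked Z) d = odd (count_below Z d) * at_level Z d.
  rewrite /at_level big_distrr /= [RHS](bigID (fun s : 'I_M => odd (count_below Z s))) /=.
  rewrite [X in _ + X]big1 ?addn0 => [|s /andP[_]]; last first.
    by case: eqP => [->/negPf->|_ _]; rewrite ?muln0.
  apply: eq_big => s; first by rewrite !inE.
  by rewrite !inE => /andP[_]; case: eqP => [->->|_ _]; rewrite ?muln0.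
have : at_level Z d <= 1.
  have [dM|Md] := ltnP d M; last first.
    by rewrite /at_level big1 // => s _; have := ltn_ord s; case: eqP => // ->; rewrite ltnNge Md.
  rewrite /at_level (leq_trans (n := \sum_s (s == Ordinal dM))) //.
    by rewrite big_mkcond /=; apply: leq_sum => s _; case: ifP.
  by rewrite -big_mkcond /= big_pred1_eq.
by case: (at_level Z d) => [|[|//]] _; lia.
Qed.

End CountBelow.

(** * The exchange inequality at a missed level *)

Section GapExchange.
Variables (R : realType) (I : finType) (G : (I -> nat) -> \bar R).
Local Open Scope ereal_scope.
Hypothesis G_gt : forall a, -oo < G a.
Hypothesis G_mid : forall a b,
  G (fun i => even_mid (a i) (b i)) + G (fun i => odd_mid (a i) (b i)) <= G a + G b.

(** This is supermodularity of [Phi] for the set of levels {v - 1, v} and its complement. The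
    arguments of G are doubled because the vertices of T sit at even positions. *)
Lemma gap_exchange (D : I -> nat) (M v : nat) : (forall i, D i <= M)%N ->
  (0 < v < M)%N -> (forall i, D i != v) ->
  G (fun i => 4 * (v < D i))%N + G (fun i => 2 * (D i - 2 * (v < D i)))%N <=
  G (fun=> 0%N) + G (fun i => 2 * D i)%N.
Proof.
move=> D_le /andP[v_gt0 v_lt] D_neq.
pose Phi (X : {set 'I_M}) := G (fun i => 2 * count_below X (D i))%N.
have PhiE (X : {set 'I_M}) a : (forall i, 2 * count_below X (D i) = a i)%N -> Phi X = G a.
  by move=> e; rewrite /Phi; congr G; apply/funext.
have Phi_loc (X : {set 'I_M}) s t : s != t -> s \notin X -> t \notin X ->
    Phi (s |: X)%SET + Phi (t |: X)%SET <= Phi X + Phi (s |: (t |: X))%SET.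
  (* For t < s the coordinates with D_i > s are among those with D_i > t, which is the nesting that
     [nested_supermodular] asks for. *)
  wlog st : s t / (t < s)%N => [wl neq_st sX tX|].
    have [|ts|/val_inj e] := ltngtP s t; last by rewrite e eqxx in neq_st.
      by rewrite addeC finset.setUCA => lt; apply: wl; rewrite // eq_sym.
    exact: wl.
  move=> neq_st sX tX.
  have := @nested_supermodular _ _ G G_gt G_mid (fun i => 2 * count_below X (D i))%N
    (fun i => s < D i)%N (fun i => t < D i)%N.
  rewrite -(PhiE (s |: X)%SET (fun i => 2 * count_below X (D i) + 2 * (s < D i))%N);
    last by move=> i; rewrite count_belowU1 // mulnDr addnC.
  rewrite -(PhiE (t |: X)%SET (fun i => 2 * count_below X (D i) + 2 * (t < D i))%N);
    last by move=> i; rewrite count_belowU1 // mulnDr addnC.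
  rewrite -(PhiE (s |: (t |: X))%SET
    (fun i => 2 * count_below X (D i) + 2 * ((s < D i) + (t < D i)))%N); last first.
    by move=> i; rewrite !count_belowU1 ?inE ?negb_or ?neq_st // -mulnDr addnA addnC.
  by apply=> i; [rewrite mul2n odd_double | apply: ltn_trans].
have Phi_mid (X Y : {set 'I_M}) : X \subset Y -> (2 < #|(Y :\: X)%SET|)%N ->
    Phi X \is a fin_num -> Phi Y \is a fin_num ->
    exists W : {set 'I_M}, [/\ X \proper W, W \proper Y & Phi W \is a fin_num].
  move=> XY card3 finX finY; pose Z := (Y :\: X)%SET; rewrite -/Z in card3.
  have card_odd : #|odd_ranked Z| = #|Z|./2.
    by rewrite -!(count_below_ge _ (leqnn M)) count_odd_ranked.
  have sub_odd : odd_ranked Z \subset Z by apply/fintype.subsetP => s; rewrite inE => /andP[].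
  have disj : [disjoint X & odd_ranked Z].
    rewrite disjoint_sym; apply: fintype.disjointWl sub_odd _.
    by rewrite -finset.setI_eq0; apply/eqP/finset.setP => s; rewrite /Z !inE; case: (s \in X); rewrite ?andbF.
  (* In each coordinate this set adds to the count of X half of what Y adds, rounded down, so that
     [fin_floor_half] gives finiteness. *)
  exists (X :|: odd_ranked Z)%SET; split.
  - have /fintype.card_gt0P[s sW] : (0 < #|odd_ranked Z|)%N by rewrite card_odd; lia.
    apply/fintype.properP; split; first exact: finset.subsetUl.
    exists s; first by rewrite inE sW orbT.
    by have := fintype.subsetP sub_odd s sW; rewrite /Z inE => /andP[].
  - have /fintype.properP[_ [s sZ sW]] : odd_ranked Z \proper Z.
      by rewrite fintype.properE sub_odd; apply: contraL card3 => /subset_leq_card; rewrite card_odd; lia.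
    apply/fintype.properP; split.
      by rewrite finset.subUset XY (fintype.subset_trans sub_odd) // finset.subsetDl.
    by move: sZ; rewrite /Z inE => /andP[sX sY]; exists s; rewrite // inE negb_or sX.
  - rewrite (PhiE _ (fun i => 2 * count_below X (D i) + 2 * (count_below Z (D i))./2)%N).
      apply: fin_floor_half => //; first by move=> i; rewrite mul2n odd_double.
      by rewrite -(PhiE Y) // => i; rewrite (count_belowD _ XY) mulnDr.
    by move=> i; rewrite count_belowU // mulnDr count_odd_ranked.
have v1_lt : (v.-1 < M)%N by lia.
pose s : 'I_M := Ordinal v1_lt; pose t : 'I_M := Ordinal v_lt.
have neq_st : s != t by rewrite -val_eqE /=; lia.
(* Since d differs from v, the levels v - 1 and v are both below d or both not. *)
have count_st d : d != v -> count_below [set s; t]%SET d = (2 * (v < d))%N.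
  move=> neq; rewrite count_belowU1 ?inE // /count_below big_set1 /=; lia.
have := @supermodular_complement _ _ Phi (fun=> G_gt _) Phi_loc Phi_mid finset.set0 [set: 'I_M]%SET
  [set s; t]%SET (finset.sub0set _) (finset.subsetT _).
rewrite (PhiE [set s; t]%SET (fun i => 4 * (v < D i))%N) => [|i]; last by rewrite count_st // mulnA.
rewrite (PhiE finset.set0 (fun=> 0%N)) => [|i]; last by rewrite /count_below big_set0.
rewrite (PhiE [set: 'I_M]%SET (fun i => 2 * D i)%N) => [|i]; last by rewrite count_belowT.
rewrite (PhiE _ (fun i => 2 * (D i - 2 * (v < D i)))%N) // => i.
have := count_belowD (D i) (finset.subsetT [set s; t]%SET).
by rewrite finset.set0U count_st // count_belowT // => {2}->; rewrite addKn.
Qed.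
End GapExchange.

(** * Geodesics in connected graphs *)

Section GraphMetric.
Variables (V : choiceType) (e : rel V).
Hypothesis e_sym : symmetric e.
Hypothesis e_conn : forall u v, exists2 s, path e u s & last u s = v.
Implicit Types (u v w : V) (gam : nat -> V).

(** Connectedness rules out the dummy value of [dist]; the definition is unfolded only here. *)
Lemma dist_path u v :
  (exists s, [/\ path e u s, last u s = v & size s = dist e u v]) /\
  (forall s, path e u s -> last u s = v -> dist e u v <= size s).
Proof.
have uv : exists k, walk_length e u v k.
  by have [s us vs] := e_conn u v; exists (size s); apply/asboolP; exists s.
rewrite /dist; case: pselect => // uv'; case: ex_minnP => k /asboolP k_walk k_min.
by split=> // s us vs; apply/k_min/asboolP; exists s.
Qed.

Lemma distxx u : dist e u u = 0.
Proof. by apply/eqP; rewrite -leqn0; apply: ((dist_path u u).2 [::]). Qed.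

Lemma dist0_eq u v : dist e u v = 0 -> u = v.
Proof. by have [[[|w s] [_ <- <-]] _] := dist_path u v. Qed.

Lemma dist_triangle v u w : dist e u w <= dist e u v + dist e v w.
Proof.
have [[[s [us vs <-]] _] [[t [vt wt <-]] _]] := (dist_path u v, dist_path v w).
rewrite -size_cat; apply: (dist_path u w).2; first by rewrite cat_path us vs.
by rewrite last_cat vs.
Qed.

Lemma dist_le_sym u v : dist e u v <= dist e v u.
Proof.
have [[s [vs us <-]] _] := dist_path v u.
have <- : size (rev (belast v s)) = size s by rewrite size_rev size_belast.
apply: (dist_path u v).2; first by rewrite -us rev_path (eq_path (e' := e)) // => a b; rewrite e_sym.
by case: s vs us => [|a s] //= _ _; rewrite rev_cons last_rcons.
Qed.

Lemma dist_sym u v : dist e u v = dist e v u.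
Proof. by apply/eqP; rewrite eqn_leq !dist_le_sym. Qed.

Lemma dist_edge u v : e u v -> dist e u v <= 1.
Proof. by move=> uv; apply: ((dist_path u v).2 [:: v]); rewrite //= uv. Qed.

Lemma dist_succ u v k : dist e u v = k.+1 -> exists2 w, e u w & dist e w v = k.
Proof.
move=> duv; have [[[|w s] [us vs us_size]] _] := dist_path u v; rewrite duv // in us_size.
case: us_size => us_size; move: us => /= /andP[uw ws]; exists w => //.
have := (dist_path w v).2 s ws vs; rewrite us_size.
by have := dist_triangle w u v; have := dist_edge uw; rewrite duv; lia.
Qed.

Definition walk gam L := forall k, k < L -> e (gam k) (gam k.+1).

Definition geodesic gam L := walk gam L /\ dist e (gam 0) (gam L) = L.

Lemma walk_dist gam L k l : walk gam L -> k <= l <= L -> dist e (gam k) (gam l) <= l - k.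
Proof.
move=> gam_walk /andP[]; elim: l => [|l IH]; first by rewrite leqn0 => /eqP-> _; rewrite distxx.
rewrite leq_eqVlt => /predU1P[->|kl] lL; first by rewrite distxx.
have := dist_edge (gam_walk l lL); have := IH kl (ltnW lL).
by have := dist_triangle (gam l) (gam k) (gam l.+1); lia.
Qed.

Lemma geodesic_dist gam L k l : geodesic gam L -> k <= l <= L -> dist e (gam k) (gam l) = l - k.
Proof.
move=> [gam_walk dist_ends] klL; have /andP[kl lL] := klL.
have := walk_dist gam_walk klL.
have : dist e (gam 0) (gam k) <= k - 0 by apply: (walk_dist gam_walk); lia.
have : dist e (gam l) (gam L) <= L - l by apply: (walk_dist gam_walk); lia.
have := dist_triangle (gam k) (gam 0) (gam L); have := dist_triangle (gam l) (gam k) (gam L).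
by lia.
Qed.

Lemma geodesic_distC gam L k l : geodesic gam L -> k <= L -> l <= L ->
  dist e (gam k) (gam l) = (k - l) + (l - k).
Proof.
move=> geo kL lL; have [kl|/ltnW lk] := leqP k l; last rewrite dist_sym.
  all: by rewrite (geodesic_dist geo); lia.
Qed.

Lemma geodesic_exists u v :
  exists gam, [/\ gam 0 = u, gam (dist e u v) = v & geodesic gam (dist e u v)].
Proof.
have [[s [us vs us_size]] _] := dist_path u v.
have gam_v : nth v (u :: s) (dist e u v) = v by rewrite -us_size -last_nth.
exists (nth v (u :: s)); split=> //; split; last by rewrite gam_v.
by move=> k; rewrite -us_size => ks; move/(pathP v): us; apply.
Qed.

(** The form in which acyclicity enters this section. It refers to a single base point because in
    T^* it is established only for base points that are vertices of T. *)
Definition unique_parent x := forall c a b, e c a -> e c b ->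
  dist e x c = (dist e x a).+1 -> dist e x c = (dist e x b).+1 -> a = b.

Section BetweenUnique.
Variables (gam : nat -> V) (L : nat).
Hypothesis gam_geo : geodesic gam L.
Hypothesis x_parent : unique_parent (gam 0).

(** Induction on the distance from c to the end of the geodesic. The next vertex c' towards that end
    lies on [gam] by induction, and both c and the predecessor of c' on [gam] are parents of c'. *)
Lemma between_unique c :
  dist e (gam 0) c + dist e c (gam L) = L -> c = gam (dist e (gam 0) c).
Proof.
have [m cL] : exists m, dist e c (gam L) = m by exists (dist e c (gam L)).
elim: m c cL => [|m IH] c cL; rewrite cL; first by rewrite addn0 => ->; exact: dist0_eq cL.
move=> dL; have [c' cc' c'L] := dist_succ cL.
have := dist_edge cc'; have := dist_triangle c (gam 0) c'; have := dist_triangle c' (gam 0) (gam L).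
rewrite gam_geo.2 c'L => ? ? ?; have d' : dist e (gam 0) c' = (dist e (gam 0) c).+1 by lia.
have ec' : c' = gam (dist e (gam 0) c).+1 by rewrite -d'; apply: IH => //; lia.
apply: (x_parent (c := c')) => //; first by rewrite e_sym.
  by rewrite ec' e_sym; apply: gam_geo.1; lia.
by rewrite d' (geodesic_dist gam_geo) ?subn0 //; lia.
Qed.

(** The equations place a and b between the ends of the whole geodesic and fix their distances from
    [gam 0], so [between_unique] identifies them. *)
Lemma midpair_geodesic k l a b : k <= l <= L ->
  dist e (gam k) (gam l) = dist e (gam k) a + dist e a b + dist e b (gam l) ->
  dist e (gam k) a = dist e b (gam l) -> dist e a b <= 1 ->
  a = gam (k + l)./2 /\ b = gam (uphalf (k + l)).
Proof.
move=> klL; rewrite (geodesic_dist gam_geo klL) => dkl da dab.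
have d0k : dist e (gam 0) (gam k) = k by rewrite (geodesic_dist gam_geo) ?subn0 //; lia.
have dlL : dist e (gam l) (gam L) = L - l by rewrite (geodesic_dist gam_geo) //; lia.
have := gam_geo.2.
have := dist_triangle a (gam 0) (gam L); have := dist_triangle b (gam 0) (gam L).
have := dist_triangle (gam k) (gam 0) a; have := dist_triangle (gam k) (gam 0) b.
have := dist_triangle (gam l) a (gam L); have := dist_triangle (gam l) b (gam L).
have := dist_triangle a (gam k) b; have := dist_triangle b a (gam l).
move=> *; have da0 : dist e (gam 0) a = (k + l)./2 by lia.
have db0 : dist e (gam 0) b = uphalf (k + l) by lia.
split.
  by rewrite (between_unique (c := a)) ?da0 //; lia.
by rewrite (between_unique (c := b)) ?db0 //; lia.
Qed.

(** The pair is ordered from the first argument to the second, hence against the direction of [gam]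
    when l < k. The explicit witnesses show that the default of [xget] is not taken. *)
Lemma midpair_half k l : k <= L -> l <= L ->
  midpair e (gam k) (gam l) = (gam (k + l)./2, gam (uphalf (k + l))) \/
  midpair e (gam k) (gam l) = (gam (uphalf (k + l)), gam (k + l)./2).
Proof.
move=> kL lL; rewrite /midpair; set S := (X in xget _ X).
have : S (xget (gam k, gam l) S).
  apply: (@xgetPex _ _ S); have [kl|lk] := leqP k l.
    exists (gam (k + l)./2, gam (uphalf (k + l))).
    by split => /=; rewrite !(geodesic_distC gam_geo); lia.
  exists (gam (uphalf (k + l)), gam (k + l)./2).
  by split => /=; rewrite !(geodesic_distC gam_geo); lia.
case: (xget _ _) => a b [/= dkl da dab]; have [kl|lk] := leqP k l.
  by left; have [||||-> ->] := @midpair_geodesic k l a b; rewrite ?kl.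
right; rewrite addnC; have [||||<- <-] := @midpair_geodesic l k b a; rewrite //.
- by rewrite (ltnW lk).
- by rewrite [LHS]dist_sym dkl [dist e (gam l) _]dist_sym [dist e b a]dist_sym [dist e a (gam k)]dist_sym; lia.
- by rewrite dist_sym -da dist_sym.
- by rewrite dist_sym.
Qed.

Variable black : pred V.
Hypothesis black_gam : forall k, k <= L -> black (gam k) = ~~ odd k.

Lemma bullet_circle_geodesic k l : k <= L -> l <= L ->
  bullet e black (gam k) (gam l) = gam (even_mid k l) /\
  circle e black (gam k) (gam l) = gam (odd_mid k l).
Proof.
move=> kL lL; have half_L : (k + l)./2 <= L by lia.
have := midpair_half kL lL; rewrite uphalf_half /bullet /circle /even_mid /odd_mid.
(* For even k + l the two middle vertices coincide. Otherwise they are adjacent and the parity of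
   their positions tells which one is black. *)
have [kl_odd|] := boolP (odd (k + l)); last first.
  by rewrite add0n addn0 /= => _ [] ->; rewrite /preceq eqxx.
have half_L' : (k + l)./2.+1 <= L by lia.
set h := (k + l)./2 in half_L half_L' *.
have eh := gam_geo.1 _ half_L'.
have neq_h : gam h != gam h.+1.
  by apply/eqP => E; have := black_gam half_L; rewrite E black_gam //=; case: (odd h).
rewrite add1n /= => -[] ->; rewrite /preceq /prec ?[_ == gam h]eq_sym (negPf neq_h) /=.
  by rewrite eh !black_gam //=; case: (odd h); rewrite /= ?addn1 ?addn0.
by rewrite e_sym eh !black_gam //=; case: (odd h); rewrite /= ?addn1 ?addn0.
Qed.

End BetweenUnique.
End GraphMetric.

(** * Trees and their edge-subdivisions *)

Section Tree.
Variables (T : choiceType) (e : rel T) (B : pred T).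
Hypothesis T_tree : is_tree e.
Hypothesis B_alt : forall u v, e u v -> B u != B v.

Let e_sym : symmetric e. Proof. by case: T_tree. Qed.
Let e_conn : forall u v, exists2 s, path e u s & last u s = v. Proof. by case: T_tree. Qed.

(** A path from u to v avoiding w could be shortened to a simple one, and w would close it to a
    cycle with at least three vertices. *)
Lemma tree_separation w u v p : e w u -> e w v -> u != v ->
  path e u p -> last u p = v -> w \in u :: p.
Proof.
move=> wu wv uv up; case: (shortenP up) => p' up' uniq_p' sub_p' p'v.
apply: contraT => w_notin.
have {}w_notin : w \notin u :: p'.
  by apply: contra w_notin; rewrite !inE; case: eqP => //= _; apply: sub_p'.
have [_ _ _ /(_ (w :: u :: p'))] := T_tree.
rewrite /ucycle cons_uniq w_notin uniq_p' /= wu rcons_path up' p'v e_sym wv => /(_ isT).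
by case: p' p'v {sub_p' uniq_p' up' w_notin} => //= uv'; rewrite uv' eqxx in uv.
Qed.

(** If a and b differed, the concatenation of shortest paths from a to x and from x to b would pass
    through c. But no vertex on them is farther from x than a or b, and c is. *)
Lemma tree_unique_parent x : unique_parent e x.
Proof.
move=> c a b ca cb da db; apply/eqP/contraT => neq_ab.
have [[s [as_ sx s_size]] _] := dist_path e_conn a x.
have [[t [xt tb t_size]] _] := dist_path e_conn x b.
have : c \in a :: (s ++ t).
  by apply: (tree_separation ca cb neq_ab); rewrite ?cat_path ?last_cat sx ?as_.
rewrite -cat_cons mem_cat => /orP[cs|ct].
  move: as_ sx s_size; case/splitPl: cs => p1 p2 p1c.
  rewrite cat_path last_cat p1c size_cat => /andP[_ p2x] lx sz.
  have := (dist_path e_conn c x).2 _ p2x lx.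
  by rewrite (dist_sym e_sym e_conn) da (dist_sym e_sym e_conn) -sz; lia.
have ct' : c \in x :: t by rewrite inE ct orbT.
move: xt tb t_size; case/splitPl: ct' => p1 p2 p1c.
rewrite cat_path size_cat => /andP[xp1 _] _ sz.
by have := (dist_path e_conn x c).2 _ xp1 p1c; rewrite db -sz; lia.
Qed.

Lemma dist_parity u v : odd (dist e u v) = (B u != B v).
Proof.
have [[s [us <- <-]] _] := dist_path e_conn u v.
elim: s u us => [|w s IH] u /=; first by rewrite eqxx.
by move=> /andP[/B_alt + /IH ->]; case: (B u) (B w) (B (last w s)) => [] [] [].
Qed.

Lemma dist_adjacent x u v : e u v ->
  dist e x u = (dist e x v).+1 \/ dist e x v = (dist e x u).+1.
Proof.
move=> uv; have := dist_parity x u; have := dist_parity x v; have := B_alt uv.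
have := dist_edge e_conn uv; have := dist_triangle e_conn u x v.
have := dist_triangle e_conn v x u; rewrite (dist_sym e_sym e_conn v u).
by case: (B u) (B v) (B x) => [] [] [] //=; lia.
Qed.

(** The distance to x changes by exactly one at each step. At an interior maximum both neighbors on
    the geodesic would be parents of the same vertex, hence equal, which a geodesic forbids. *)
Lemma geodesic_interior_closer gam L x r k : geodesic e gam L ->
  dist e x (gam 0) = r -> dist e x (gam L) = r -> 0 < k < L -> dist e x (gam k) < r.
Proof.
move=> geo d0 dL /andP[k_gt0 kL]; rewrite ltnNge; apply/negP => rk.
have [j [j_gt0 jL j_max]] : exists j, [/\ 0 < j, j < L &
    forall l, l <= L -> dist e x (gam l) <= dist e x (gam j)].
  pose f (i : 'I_L.+1) := dist e x (gam i).
  have kL' : k < L.+1 by rewrite ltnS ltnW.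
  have [i _ i_max] := @arg_maxnP _ (Ordinal kL') xpredT f isT.
  have {}i_max l : l <= L -> dist e x (gam l) <= f i.
    by rewrite -ltnS => lL; apply: (i_max (Ordinal lL)).
  have [i_int|i_end] := boolP (0 < i < L); first by exists i; case/andP: i_int.
  (* The maximum found is at an end and equals r, so k, at distance at least r, attains it too. *)
  exists k; split=> // l /i_max /leq_trans; apply; apply: leq_trans rk.
  have : (i == 0 :> nat) || (i == L :> nat) by have := ltn_ord i; lia.
  by rewrite /f => /orP[] /eqP ->; rewrite ?d0 ?dL.
have jP : e (gam j) (gam j.-1) by rewrite e_sym -{2}(prednK j_gt0); apply: geo.1; lia.
have jS : e (gam j) (gam j.+1) by apply: geo.1.
have := @tree_unique_parent x _ _ _ jP jS.
have := dist_adjacent x jP; have := dist_adjacent x jS.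
have := j_max j.-1; have := j_max j.+1 => m1 m2 a1 a2 E.
have {}E : gam j.-1 = gam j.+1 by apply: E; lia.
have := geodesic_distC e_sym e_conn geo (k := j.-1) (l := j.+1); rewrite E (distxx e_conn); lia.
Qed.

Local Notation S := (subdiv e).
Local Notation se := (@subdiv_adj T e).
Local Notation sb := (@subdiv_black T e).

Lemma subdiv_sym : symmetric se.
Proof. by case=> [u|A] [v|A']. Qed.

Lemma edge_pair (A : edge e) u w : val A u -> val A w -> u != w ->
  e u w /\ val A = [set u; w]%classic.
Proof.
case: A => A /= /[dup] /asboolP[a [b [ab ->]]] _ [->|->] [->|->]; rewrite ?eqxx // => _.
by rewrite e_sym; split=> //; rewrite classical_sets.setUC.
Qed.

Lemma edge_dist (A : edge e) u w : val A u -> val A w -> dist e u w <= 1.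
Proof.
move=> Au Aw; have [->|/(edge_pair Au Aw)[uw _]] := eqVneq u w.
  by rewrite (distxx e_conn).
exact: dist_edge.
Qed.

Lemma edge_exists u v : e u v -> {A : edge e | val A = [set u; v]%classic}.
Proof.
move=> uv; have A_edge : `[< exists a b, e a b /\ [set u; v]%classic = [set a; b]%classic >].
  by apply/asboolP; exists u, v.
by exists (exist (fun A : set T => `[< exists a b, e a b /\ A = [set a; b]%classic >]) _ A_edge).
Qed.

Lemma subdiv_path u s : path e u s ->
  exists2 t, path se (inl u) t & last (inl u) t = inl (last u s) /\ size t = 2 * size s.
Proof.
elim: s u => [|v s IH] u /=; first by exists [::].
move=> /andP[/edge_exists[A A_uv] /IH[t vt [t_last t_size]]].
exists (inr A :: inl v :: t); last by rewrite /= t_last t_size mulnS.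
rewrite /= vt andbT A_uv; apply/andP; split; apply/asboolP; [by left|by right].
Qed.

Lemma subdiv_conn (a b : S) : exists2 s, path se a s & last a s = b.
Proof.
have to_vertex (c : S) : exists u s, path se c s /\ last c s = inl u.
  case: c => [u|A]; first by exists u, [::].
  have := valP A => /asboolP[u [v [_ Auv]]]; exists u, [:: inl u].
  by split=> //=; rewrite andbT; apply/asboolP; rewrite Auv; left.
have [u [s [as_ su]]] := to_vertex a; have [v [t [bt tv]]] := to_vertex b.
have [p up p_last] := e_conn u v; have [q uq [q_last _]] := subdiv_path up.
exists (s ++ q ++ rev (belast b t)).
  rewrite !cat_path as_ su uq q_last p_last -tv rev_path.
  by rewrite (eq_path (e' := se)) // => c d; rewrite subdiv_sym.
rewrite !last_cat su q_last p_last -tv.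
by case: t {bt tv} => //= c t; rewrite rev_cons last_rcons.
Qed.

(** For the lower bound, a walk in T^* between vertices of T is read two steps at a time: each pair
    of steps passes through a midpoint and moves by at most one edge of T, possibly returning to the
    same vertex. *)
Lemma subdiv_dist u v : dist se (inl u) (inl v) = 2 * dist e u v.
Proof.
apply/eqP; rewrite eqn_leq; apply/andP; split.
  have [[s [us <- <-]] _] := dist_path e_conn u v.
  have [t ut [t_last <-]] := subdiv_path us.
  exact: (dist_path subdiv_conn _ _).2.
have [[s [us sv <-]] _] := dist_path subdiv_conn (inl u) (inl v).
have [N] := ubnP (size s); elim: N s u us sv => // N IH [|[?|A] [|[w|A'] s]] u //=.
- by move=> _ [->]; rewrite (distxx e_conn).
- move=> /and3P[/asboolP Au /asboolP Aw ws] sv; rewrite !ltnS => /ltnW sN.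
  have tri : dist e u v <= (dist e w v).+1.
    by have := dist_triangle e_conn w u v; have := edge_dist Au Aw; lia.
  apply: leq_trans (leq_mul (leqnn 2) tri) _; rewrite mulnS.
  exact: IH ws sv sN.
- by rewrite andbF.
Qed.

(** The two ends of an edge have different distances to x, so a midpoint has one parent. A midpoint
    that is a parent of a vertex c belongs to the edge from c to its parent in T, which is
    unique. *)
Lemma subdiv_unique_parent x : unique_parent se (inl x).
Proof.
case=> [c|A] [a|A1] [b|A2] //=; last first.
  move=> /asboolP Aa /asboolP Ab -> [E]; have [->//|neq_ab] := eqVneq a b.
  have [/(dist_adjacent x) ab _] := edge_pair Aa Ab neq_ab.
  by move: E; rewrite !subdiv_dist; lia.
move=> /asboolP Ac1 /asboolP Ac2; rewrite subdiv_dist => d1 d2.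
have nearer (A : edge e) : val A c -> 2 * dist e x c = (dist se (inl x) (inr A)).+1 ->
    exists w, [/\ e c w, dist e x c = (dist e x w).+1 & val A = [set c; w]%classic].
  move=> Ac dA; have [k dk] : exists k, dist se (inr A) (inl x) = k.+1.
    by rewrite (dist_sym subdiv_sym subdiv_conn); exists (2 * dist e x c - 2); lia.
  have [[w|//] /= /asboolP Aw wk] := dist_succ subdiv_conn dk.
  move: wk dk dA; rewrite ![dist se _ (inl x)](dist_sym subdiv_sym subdiv_conn) subdiv_dist => wk dk dA.
  have dw : dist e x c = (dist e x w).+1 by lia.
  have neq_cw : c != w by apply/eqP => E; rewrite E in dw; lia.
  by have [cw ->] := edge_pair Ac Aw neq_cw; exists w.
have [w1 [cw1 dw1 A1E]] := nearer A1 Ac1 d1; have [w2 [cw2 dw2 A2E]] := nearer A2 Ac2 d2.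
by congr inr; apply: val_inj; rewrite A1E A2E (tree_unique_parent cw1 cw2 dw1 dw2).
Qed.

(** The value [inl (gam 0)] at odd positions is a default for pairs that are not edges; it does not
    occur along a walk. *)
Definition subdiv_line (gam : nat -> T) (k : nat) : S :=
  if odd k then
    if insub [set gam k./2; gam k./2.+1]%classic is Some A then inr A else inl (gam 0)
  else inl (gam k./2).

Lemma subdiv_line_double gam k : subdiv_line gam (2 * k) = inl (gam k).
Proof. by rewrite /subdiv_line mul2n odd_double doubleK. Qed.

Lemma subdiv_line_odd gam L k : walk e gam L -> k < L ->
  exists2 A : edge e, subdiv_line gam (2 * k).+1 = inr A & val A = [set gam k; gam k.+1]%classic.
Proof.
move=> gam_walk kL; have [A AE] := edge_exists (gam_walk k kL); exists A => //.
by rewrite /subdiv_line /= mul2n odd_double uphalf_double -AE valK.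
Qed.

Lemma subdiv_line_geodesic gam L : geodesic e gam L -> geodesic se (subdiv_line gam) (2 * L).
Proof.
move=> [gam_walk gam_dist]; split; last first.
  by rewrite (subdiv_line_double gam 0) subdiv_line_double subdiv_dist gam_dist.
move=> k kL; have kL' : k./2 < L by lia.
have [A AE Aval] := subdiv_line_odd gam_walk kL'.
have [k_odd|k_even] := boolP (odd k).
  have -> : k = (2 * k./2).+1 by lia.
  rewrite AE (_ : (2 * k./2).+2 = 2 * k./2.+1) ?subdiv_line_double; last by lia.
  by apply/asboolP; rewrite Aval; right.
have -> : k = 2 * k./2 by lia.
by rewrite AE subdiv_line_double; apply/asboolP; rewrite Aval; left.
Qed.

Lemma subdiv_line_black gam L k : walk e gam L -> k <= 2 * L ->
  sb (subdiv_line gam k) = ~~ odd k.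
Proof.
move=> gam_walk kL; have [k_odd|k_even] := boolP (odd k).
  have -> : k = (2 * k./2).+1 by lia.
  by have [|A -> _] := @subdiv_line_odd gam L k./2 gam_walk; first by lia.
have -> : k = 2 * k./2 by lia.
by rewrite subdiv_line_double.
Qed.

End Tree.

(** * Descent towards x and existence of a near minimizer *)

Section Proximity.
Variables (R : realType) (T : choiceType) (e : rel T) (B : pred T) (n : nat).
Variables (h : {ffun 'I_n -> T} -> \bar R) (g : {ffun 'I_n -> subdiv e} -> \bar R).
Hypothesis T_tree : is_tree e.
Hypothesis B_alt : forall u v, e u v -> B u != B v.
Hypothesis hg : L_convex_relaxation h g.
Local Open Scope ereal_scope.
Implicit Types x y z : {ffun 'I_n -> T}.

Let e_sym : symmetric e. Proof. by case: T_tree. Qed.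
Let e_conn : forall u v, exists2 s, path e u s & last u s = v. Proof. by case: T_tree. Qed.

Let h_gt y : -oo < h y.
Proof. by have [[g_gt _] <-] := hg. Qed.

(** G is g along the subdivided geodesics and +oo outside the box. The box is closed under both
    roundings, so midpoint convexity holds for all integer points without range conditions. *)
Lemma geodesic_box x y : exists (gam : 'I_n -> nat -> T) (G : ('I_n -> nat) -> \bar R),
  [/\ forall i, [/\ gam i 0%N = x i, gam i (dist e (x i) (y i)) = y i
        & geodesic e (gam i) (dist e (x i) (y i))],
      forall a, -oo < G a,
      forall a b, G (fun i => even_mid (a i) (b i)) + G (fun i => odd_mid (a i) (b i)) <= G a + G b
    & forall a, (forall i, a i <= dist e (x i) (y i))%N ->
        G (fun i => 2 * a i)%N = h [ffun i => gam i (a i)]].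
Proof.
have [gam gamP] := choice (fun i => geodesic_exists e_conn (x i) (y i)).
pose D i := dist e (x i) (y i).
pose pt (a : 'I_n -> nat) : {ffun 'I_n -> subdiv e} := [ffun i => subdiv_line e (gam i) (a i)].
pose in_box (a : 'I_n -> nat) := [forall i, a i <= 2 * D i]%N.
have [[g_gt g_conv] gh] := hg.
exists gam, (fun a => if in_box a then g (pt a) else +oo); split=> //.
- by move=> a; case: ifP.
- move=> a b; case: (boolP (in_box a)) => [/forallP a_box|_]; last first.
    by rewrite addye ?leey //; case: ifP => // _; rewrite gt_eqF.
  case: (boolP (in_box b)) => [/forallP b_box|_]; last by rewrite addey ?leey // gt_eqF.
  have -> : in_box (fun i => even_mid (a i) (b i)) by apply/forallP => i; apply: even_mid_le.
  have -> : in_box (fun i => odd_mid (a i) (b i)) by apply/forallP => i; apply: odd_mid_le.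
  have mid i : bullet (@subdiv_adj T e) (@subdiv_black T e) (pt a i) (pt b i) =
        subdiv_line e (gam i) (even_mid (a i) (b i)) /\
      circle (@subdiv_adj T e) (@subdiv_black T e) (pt a i) (pt b i) =
        subdiv_line e (gam i) (odd_mid (a i) (b i)).
    have [_ _ geo] := gamP i; rewrite !ffunE.
    apply: (bullet_circle_geodesic (@subdiv_sym T e) (subdiv_conn T_tree)
      (subdiv_line_geodesic T_tree geo)) => //; first exact: (subdiv_unique_parent T_tree B_alt).
    by move=> k; apply: subdiv_line_black; case: geo.
  have := g_conv (pt a) (pt b).
  have -> : bullet_prod (@subdiv_adj T e) (@subdiv_black T e) (pt a) (pt b) =
      pt (fun i => even_mid (a i) (b i)).
    by apply/ffunP => i; rewrite [LHS]ffunE (mid i).1 [RHS]ffunE.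
  have -> // : circle_prod (@subdiv_adj T e) (@subdiv_black T e) (pt a) (pt b) =
      pt (fun i => odd_mid (a i) (b i)).
  by apply/ffunP => i; rewrite [LHS]ffunE (mid i).2 [RHS]ffunE.
- move=> a a_le; have -> : in_box (fun i => 2 * a i)%N.
    by apply/forallP => i; rewrite leq_mul2l a_le.
  rewrite -gh; congr g; apply/ffunP => i.
  by rewrite !ffunE subdiv_line_double.
Qed.

Lemma closer_point x y : minimizer_over h [set p | forall i, B (p i)]%classic x ->
  h x < +oo -> (n < dist_prod e x y)%N ->
  exists y', h y' <= h y /\ (\sum_i dist e (x i) (y' i) < \sum_i dist e (x i) (y i))%N.
Proof.
move=> [Bx x_min] x_dom far; pose D i := dist e (x i) (y i).
have [gam [G [gamP G_gt G_mid Gh]]] := geodesic_box x y.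
have [i0 Di0] : exists i, (n < D i)%N.
  apply/existsP; apply: contraLR far; rewrite negb_exists -leqNgt => /forallP le_n.
  by apply/bigmax_leqP => i _; rewrite leqNgt; apply: le_n.
(* Pigeonhole: otherwise 1, ..., n and D_i0 > n would be n + 1 distinct values taken by the n
   coordinates. *)
have [v [v_gt0 v_le D_neq]] : exists v, [/\ (0 < v)%N, (v <= n)%N & forall i, D i != v].
  have /hasP[v] : has [pred v | v \notin codom D] (iota 1 n).
    apply/negPn; rewrite -all_predC; apply/negP => /allP D_all.
    have : (size (D i0 :: iota 1 n) <= size (codom D))%N.
      apply: uniq_leq_size => [|v].
        by rewrite cons_uniq iota_uniq mem_iota andbT; lia.
      by rewrite inE => /predU1P[->|/D_all/negPn//]; apply: codom_f.
    by rewrite /= size_codom size_iota card_ord ltnn.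
  rewrite mem_iota => /andP[v_gt0 v_le] /= vD; exists v; split=> [||i] //.
  by apply: contraNneq vD => <-; apply: codom_f.
pose M := (\max_i D i).+1.
have D_le i : (D i <= M)%N by apply: leqW; apply: leq_bigmax.
have vM : (0 < v < M)%N.
  by rewrite v_gt0 ltnS (leq_trans v_le) // (leq_trans (ltnW Di0)) // leq_bigmax.
have := gap_exchange G_gt G_mid D_le vM D_neq.
have -> : (fun i => 4 * (v < D i))%N = (fun i => 2 * (2 * (v < D i)))%N :> ('I_n -> nat).
  by apply/funext => i; rewrite mulnA.
have -> : (fun=> 0%N) = (fun i => 2 * 0)%N :> ('I_n -> nat) by apply/funext => i.
have step_le i : (2 * (v < D i) <= D i)%N by case: ltnP => //; lia.
rewrite !Gh // => [|i]; last exact: leq_subr.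
set x' := finfun _; set y' := finfun _; rewrite (_ : finfun _ = x); last first.
  by apply/ffunP => i; rewrite ffunE; case: (gamP i).
rewrite (_ : finfun _ = y); last by apply/ffunP => i; rewrite ffunE; case: (gamP i).
move=> exch; exists y'; split.
  (* Each coordinate of x moves by 0 or 2 steps and keeps its color, so h x <= h x'. As h x is
     finite, it cancels from [exch]. *)
  have Bx' i : B (x' i).
    have [g0 _ geo] := gamP i; have := dist_parity T_tree B_alt (x i) (x' i).
    rewrite ffunE -{1}g0 (geodesic_dist e_conn geo) //= ?step_le // subn0 mul2n odd_double.
    by rewrite (Bx i); case: (B _).
  have x_fin : h x \is a fin_num by rewrite fin_numElt h_gt.
  rewrite -(leeD2lE _ _ x_fin); apply: le_trans exch.
  by rewrite leeD2r // x_min.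
have dist_y' i : dist e (x i) (y' i) = (D i - 2 * (v < D i))%N.
  have [g0 _ geo] := gamP i.
  by rewrite ffunE -{1}g0 (geodesic_dist e_conn geo) ?subn0 //= leq_subr.
rewrite (bigD1 i0) //= [X in (_ < X)%N](bigD1 i0) //= -addSn; apply: leq_add.
  by rewrite dist_y' -/(D i0) (leq_ltn_trans v_le Di0); lia.
by apply: leq_sum => i _; rewrite dist_y' leq_subr.
Qed.

Lemma near_point x y : minimizer_over h [set p | forall i, B (p i)]%classic x ->
  h x < +oo -> exists y', h y' <= h y /\ (dist_prod e x y' <= n)%N.
Proof.
move=> x_min x_dom; have [k] := ubnP (\sum_i dist e (x i) (y i))%N.
elim: k y => // k IH y y_lt; have [y_le|y_gt] := leqP (dist_prod e x y) n.
  by exists y.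
have [y' [hy' y'_lt]] := closer_point x_min x_dom y_gt.
have [z [hz z_le]] := IH y' (leq_trans y'_lt y_lt).
by exists z; split=> //; apply: le_trans hz hy'.
Qed.

(** Vertices at equal distance from x_i have the same color, so the distances between y and y' are
    even and their midpoint m is a point of T^n. No rounding occurs, and the interior points of each
    geodesic are closer to x_i than its ends. *)
Lemma midpoint_descent x y y' : (forall i, dist e (x i) (y i) = dist e (x i) (y' i)) ->
  h y' < h y -> exists m, [/\ h m <= h y, forall i, (dist e (x i) (m i) <= dist e (x i) (y i))%N
    & (\sum_i dist e (x i) (m i) < \sum_i dist e (x i) (y i))%N].
Proof.
move=> dist_eq hy'y; pose D i := dist e (y i) (y' i).
have [gam [G [gamP G_gt G_mid Gh]]] := geodesic_box y y'.
have D_even i : D i = (2 * (D i)./2)%N.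
  have := dist_parity T_tree B_alt (y i) (y' i).
  have := dist_parity T_tree B_alt (x i) (y i); have := dist_parity T_tree B_alt (x i) (y' i).
  by rewrite dist_eq -/(D i) => ->; case: (B (x i)) (B (y i)) (B (y' i)) => [] [] [] //=; lia.
have half_le i : ((D i)./2 <= D i)%N by rewrite [leqRHS]D_even; lia.
pose m : {ffun 'I_n -> T} := [ffun i => gam i (D i)./2].
have hm : h m + h m <= h y + h y'.
  have := midpoint_exact G_mid (fun=> 0%N) D.
  have -> : (fun i => 0 + D i)%N = (fun i => 2 * (D i)./2)%N.
    by apply/funext => i; rewrite add0n -D_even.
  have -> : (fun=> 0%N) = (fun i => 2 * 0)%N :> ('I_n -> nat) by apply/funext => i.
  have -> : (fun i => 2 * 0 + 2 * D i)%N = (fun i => 2 * D i)%N by [].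
  rewrite !Gh //; congr (_ <= h _ + h _); apply/ffunP => i; rewrite ffunE.
    by case: (gamP i).
  by case: (gamP i).
have m_lt i : (0 < D i)%N -> (dist e (x i) (m i) < dist e (x i) (y i))%N.
  have [g0 gD geo] := gamP i => D_gt0; rewrite ffunE.
  apply: (geodesic_interior_closer T_tree B_alt geo); rewrite ?g0 ?gD //.
  by have := D_even i; rewrite -/(D i); lia.
have m_eq i : D i = 0%N -> m i = y i.
  by move=> D0; rewrite ffunE D0; case: (gamP i).
have m_le i : (dist e (x i) (m i) <= dist e (x i) (y i))%N.
  by have [/m_eq->//|/m_lt/ltnW] := posnP (D i).
exists m; split=> //.
  (* If h m exceeded h y, it would exceed h y' as well, against [hm]. *)
  rewrite leNgt; apply/negP => ym.
  by have := lteD ym (lt_trans hy'y ym); rewrite ltNge hm.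
have [i0 Di0] : exists i, (0 < D i)%N.
  apply/existsP; apply: contraPT hy'y; rewrite negb_exists => /forallP D0.
  have -> : y = y' by apply/ffunP => i; apply: (dist0_eq e_conn); apply/eqP; rewrite -leqn0 leqNgt; apply: D0.
  by rewrite ltxx.
rewrite (bigD1 i0) //= [X in (_ < X)%N](bigD1 i0) //= -addSn; apply: leq_add; first exact: m_lt.
by apply: leq_sum.
Qed.

Lemma near_minimizer x : minimizer_over h [set p | forall i, B (p i)]%classic x ->
  h x < +oo -> exists y, minimizer_over h setT y /\ (dist_prod e x y <= n)%N.
Proof.
move=> x_min x_dom.
pose depth y (r : {ffun 'I_n -> 'I_n.+1}) := forall i, dist e (x i) (y i) = r i.
pose attained r z := depth z r /\ forall y, depth y r -> h z <= h y.
have le_dist_prod y i : (dist e (x i) (y i) <= dist_prod e x y)%N.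
  exact: (leq_bigmax (F := fun i => dist e (x i) (y i))).
(* Either y is lowest among the points with the same distances to x, or [midpoint_descent] gives a
   point that is no higher, still in the ball, and has smaller total distance to x. *)
have dominated y : (dist_prod e x y <= n)%N -> exists r z, attained r z /\ h z <= h y.
  have [k] := ubnP (\sum_i dist e (x i) (y i))%N.
  elim: k y => // k IH y y_lt y_le.
  pose r : {ffun 'I_n -> 'I_n.+1} := [ffun i => inord (dist e (x i) (y i))].
  have y_depth : depth y r.
    by move=> i; rewrite ffunE inordK // ltnS (leq_trans (le_dist_prod y i)).
  have [y_att|/existsNP[y' /not_implyP[y'_depth /negP]]] := pselect (forall y', depth y' r -> h y <= h y').
    by exists r, y.
  rewrite -ltNge => hy'y.
  have [|m [hm m_le m_lt]] := midpoint_descent (x := x) _ hy'y.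
    by move=> i; rewrite y_depth y'_depth.
  have [||r' [z [z_att hz]]] := IH m; first exact: leq_trans m_lt _.
    by apply/bigmax_leqP => i _; rewrite (leq_trans (m_le i)) // (leq_trans (le_dist_prod y i)).
  by exists r', z; split=> //; apply: le_trans hz hm.
pose P r := `[< exists z, attained r z >].
(* There are finitely many distance vectors, so that the best of the points
   [zmin r] is a minimizer. *)
have att_ex r : exists z, P r -> attained r z.
  by have [/asboolP[z rz]|] := boolP (P r); [exists z|exists x].
have [zmin zminP] := choice att_ex.
have [r0 [z0 [z0_att _]]] : exists r z, attained r z /\ h z <= h x.
  apply: dominated; apply/bigmax_leqP => i _; by rewrite (distxx e_conn).
have Pr0 : P r0 by apply/asboolP; exists z0.
have [r Pr r_min] := arg_minP (h \o zmin) Pr0.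
exists (zmin r); have [r_depth _] := zminP r Pr; split; last first.
  by apply/bigmax_leqP => i _; rewrite r_depth -ltnS.
split=> // y _; have [y' [hy' y'_le]] := near_point y x_min x_dom.
have [r' [z [z_att hz]]] := dominated y' y'_le.
have Pr' : P r' by apply/asboolP; exists z.
apply: le_trans (r_min r' Pr') _; apply: le_trans hy'; apply: le_trans hz.
by have [_] := zminP r' Pr'; apply; case: z_att.
Qed.

End Proximity.

Local Open Scope classical_set_scope.

Theorem theorem2p11 (R : realType) (T : choiceType) (e : rel T) (B W : pred T)
    (n : nat) (h : {ffun 'I_n -> T} -> \bar R) (x : {ffun 'I_n -> T})
    (T_tree : is_tree e) (BW : color_classes e B W) (n_gt0 : 0 < n)
    (h_ext : midpoint_L_extendable e h)
    (x_min : minimizer_over h [set p : {ffun 'I_n -> T} | forall i, B (p i)] x)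
    (x_dom : (h x < +oo)%E) :
  (exists y, minimizer_over h setT y /\ dist_prod e x y <= 2 * n) /\
  ((exists g, exact_L_convex_relaxation (e := e) h g) ->
   exists y, minimizer_over h setT y /\ dist_prod e x y <= n).
Proof.
have [g hg] := h_ext; have [_ B_alt] := BW.
have [y [y_min y_le]] := near_minimizer T_tree B_alt hg x_min x_dom.
(* The same y, at distance at most n, proves both claims. *)
split=> [|_]; exists y; split=> //; lia.
Qed.
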